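(* There exists a constant $c>0$ such that, as $n\to\infty$, $$\mathrm{pnw}(n)=\Omega\left(2^{\,n-c\sqrt{n\ln n}}\right).$$ Consequently, for every $\epsilon$ with $0<\epsilon<2$, $\mathrm{pnw}(n)=\Omega\left((2-\epsilon)^n\right)$ as $n\to\infty$.
   Context: A binary word is a finite sequence over $\{0,1\}$. A binary word $w$ is prefix normal if for every $1\le i\le |w|$, no (contiguous) substring of $w$ of length $i$ contains more $1$s than the prefix of $w$ of length $i$. $\mathrm{pnw}(n)$ denotes the number of prefix normal words of length $n$. $f(n)=\Omega(g(n))$ means there are $C>0$ and $n_0$ with $f(n)\ge C g(n)$ for all $n\ge n_0$. *)

(* Defs.v *)
From mathcomp Require Import all_boot.

Set Implicit Arguments.
Unset Strict Implicit.
Unset Printing Implicit Defensive.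

(* Words are over bool, with true standing for the letter 1 and false for 0.  *)
Definition prefix_normal (w : seq bool) : bool :=
  [forall i : 'I_(size w).+1, (1 <= i) ==>
    [forall u : i.-tuple bool, infix u w ==>
      (count_mem true u <= count_mem true (take i w))]].

Definition pnw (n : nat) : nat := #|[set w : n.-tuple bool | prefix_normal w]|.

(* Main.v *)
Require Import Defs.
From mathcomp Require Import all_boot all_order all_algebra.
From mathcomp Require Import all_classical all_reals all_analysis.
From mathcomp Require Import zify ring lra.

(* A word 1^k v is prefix normal as soon as every prefix of v of length j has *)
(* between (j - l)/2 and (j + l)/2 ones, where 3 l <= k. A concatenation of q *)
(* blocks of length 2 l, each with exactly l ones, is such a v, hence         *)
(* pnw n >= 'C(2 l, l)^q >= (4^l / (2 l + 1))^q where q is about              *)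
(* (n - 3 l) / (2 l). With l of order sqrt (n ln n), both the forced letters  *)
(* (at most 5 l) and the factors 2 l + 1 cost O(sqrt (n ln n)) bits.          *)

Set Implicit Arguments.
Unset Strict Implicit.
Unset Printing Implicit Defensive.

Import Order.TTheory GRing.Theory Num.Theory.
Import numFieldNormedType.Exports.

(** Prefix normality amounts to subadditivity of the prefix counts of ones, and a long enough
    initial run of ones absorbs every bounded fluctuation that follows it
    ([prefix_normal_nseq_cat]). Words built from balanced blocks fluctuate by at most half a block,
    so their number bounds [pnw n] from below ([central_bin_exp_le_pnw]). With [central_bin_ge],
    which says that a block loses only a polynomial factor against all words of its length, this
    becomes the explicit inequality [expn2_le_pnw]. Short blocks waste factors [2 * l + 1], long
    ones waste forced letters; [l] of order sqrt (n ln n) balances the two losses ([pnw_ge_powR]).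
    The exponential bound follows because sqrt (n ln n) is o(n). *)

Lemma prefix_normal_subadd (w : seq bool) :
  (forall s i, s + i <= size w -> count_mem true (take (s + i) w) <=
     count_mem true (take s w) + count_mem true (take i w)) ->
  prefix_normal w.
Proof.
move=> subadd; apply/forallP => -[i lt_iw] /=; apply/implyP => _.
apply/forallP => u; apply/implyP => /infixP [s1 [s2 def_w]].
have le_sw : size s1 + i <= size w.
  by rewrite def_w !size_cat (size_tuple u) addnA leq_addr.
have -> : count_mem true u = count_mem true (take (size s1 + i) w) -
    count_mem true (take (size s1) w).
  rewrite takeD count_cat addKn def_w drop_size_cat // take_size_cat //.
  by rewrite (size_tuple u).
by rewrite leq_subLR subadd.
Qed.

Lemma count_takeD (T : Type) (a : pred T) (s : seq T) i j :
  count a (take (i + j) s) <= count a (take i s) + j.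
Proof.
rewrite takeD count_cat leq_add2l (leq_trans (count_size _ _)) //.
by rewrite size_take_min geq_minl.
Qed.

Definition near_balanced l (v : seq bool) :=
  forall j, j <= size v ->
    2 * count_mem true (take j v) <= j + l /\ j <= 2 * count_mem true (take j v) + l.

Lemma count_take_nseq_cat k (v : seq bool) j :
  count_mem true (take j (nseq k true ++ v)) =
    if j <= k then j else k + count_mem true (take (j - k) v).
Proof.
rewrite take_cat size_nseq; case: (ltngtP j k) => [lt_jk|lt_kj|->].
- by rewrite take_nseq ?count_nseq ?mul1n // ltnW.
- by rewrite count_cat count_nseq mul1n.
- by rewrite subnn take0 cats0 count_nseq mul1n.
Qed.

(** If [i] or [s] is at most [k], that prefix is all ones and subadditivity is trivial. Otherwise
    the run is counted twice on the right and once on the left: doubled, this gains [k] over the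
    balanced count, while the three prefixes of [v] involved can lose at most [l] each, whence
    [3 * l <= k]. *)
Lemma prefix_normal_nseq_cat l k (v : seq bool) :
  3 * l <= k -> near_balanced l v -> prefix_normal (nseq k true ++ v).
Proof.
move=> le_lk bal_v; apply: prefix_normal_subadd => s i.
rewrite size_cat size_nseq => le_si.
have [le_ik | lt_ki] := leqP i k.
  by rewrite (count_take_nseq_cat k v i) le_ik count_takeD.
have [le_sk | lt_ks] := leqP s k.
  rewrite addnC [X in _ <= X]addnC (count_take_nseq_cat k v s) le_sk.
  exact: count_takeD.
rewrite !count_take_nseq_cat !ifN -?ltnNge //; last lia.
have := bal_v (s + i - k); have := bal_v (s - k); have := bal_v (i - k); lia.
Qed.

Fixpoint words_of_weight n m : seq (seq bool) :=
  match n, m with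
  | 0, 0 => [:: [::]]
  | 0, _.+1 => [::]
  | n'.+1, 0 => map (cons false) (words_of_weight n' 0)
  | n'.+1, m'.+1 => map (cons false) (words_of_weight n' m'.+1) ++
                    map (cons true) (words_of_weight n' m')
  end.

Lemma size_words_of_weight n m : size (words_of_weight n m) = 'C(n, m).
Proof.
elim: n m => [|n IHn] [|m] //=; first by rewrite size_map IHn !bin0.
by rewrite size_cat !size_map !IHn binS.
Qed.

Lemma words_of_weight_uniq n m : uniq (words_of_weight n m).
Proof.
have cons_inj b : injective (cons b : seq bool -> seq bool) by move=> s t [].
elim: n m => [|n IHn] [|m] //=; first by rewrite map_inj_uniq.
rewrite cat_uniq !map_inj_uniq ?IHn //= andbT.
by apply/hasPn => _ /mapP[s _ ->]; apply/mapP => -[].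
Qed.

Lemma mem_words_of_weight n m w :
  w \in words_of_weight n m -> size w = n /\ count_mem true w = m.
Proof.
elim: n m w => [|n IHn] [|m] w //=; first by rewrite inE => /eqP ->.
  by case/mapP => s /IHn[<- <-] ->.
by rewrite mem_cat => /orP[] /mapP[s /IHn[<- <-] ->].
Qed.

Fixpoint balanced_words l q : seq (seq bool) :=
  if q is q'.+1 then
    [seq u ++ v | u <- words_of_weight (2 * l) l, v <- balanced_words l q']
  else [:: [::]].

Lemma size_balanced_words l q : size (balanced_words l q) = 'C(2 * l, l) ^ q.
Proof.
by elim: q => //= q IHq; rewrite size_allpairs IHq size_words_of_weight expnS.
Qed.

Lemma mem_balanced_words l q v : v \in balanced_words l q ->
  size v = 2 * l * q /\ near_balanced l v.
Proof.
elim: q v => [|q IHq] v /=.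
  by rewrite inE muln0 => /eqP->; split=> // -[].
case/allpairsP => -[u v'] /= [/mem_words_of_weight[szu cu] /IHq[szv bal] ->].
split=> [|j]; first by rewrite size_cat szu szv mulnS.
rewrite size_cat take_cat szu => le_j.
case: ltnP => [lt_ju | le_uj]; last first.
  have /bal[] : j - 2 * l <= size v' by rewrite leq_subLR.
  by rewrite count_cat cu; split; lia.
have le_take : count_mem true (take j u) <= j.
  by rewrite (leq_trans (count_size _ _)) // size_take_min geq_minl.
have le_drop : count_mem true (drop j u) <= 2 * l - j.
  by rewrite (leq_trans (count_size _ _)) // size_drop szu.
(* Within a block, [c] is at most both [j] and [l], and at least both [0] and [j - l]; adding the
   two bounds on each side gives the discrepancy [l]. *)
move: cu le_take le_drop; rewrite -{1}(cat_take_drop j u) count_cat.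
move: (count _ (take j u)) (count _ (drop j u)) => c d; split; lia.
Qed.

Lemma balanced_words_uniq l q : uniq (balanced_words l q).
Proof.
elim: q => //= q IHq; apply: allpairs_uniq; rewrite ?words_of_weight_uniq //.
move=> [u v] [u' v'] /allpairsP[p [/mem_words_of_weight[szu _] _ [-> ->]]].
case/allpairsP=> p' [/mem_words_of_weight[szu' _] _ [-> ->]] /= /eqP.
by rewrite eqseq_cat ?szu // => /andP[/eqP-> /eqP->].
Qed.

Lemma pnw_ge_size n (s : seq (seq bool)) :
  uniq s -> (forall w, w \in s -> size w = n /\ prefix_normal w) ->
  size s <= pnw n.
Proof.
move=> uniq_s s_pn; rewrite /pnw cardE -(size_map val).
apply: uniq_leq_size => // w /s_pn[szw pnw_w].
apply/mapP; exists (Tuple (introT eqP szw)) => //.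
by rewrite mem_enum inE.
Qed.

(** Induction through 'C(2l+2, l+1) (l+1) = 2 (2l+1) 'C(2l, l), obtained by combining [diag] and
    [down]. *)
Lemma central_bin_ge l : 4 ^ l <= 'C(2 * l, l) * (2 * l).+1.
Proof.
elim: l => [|l IHl]; first by rewrite bin0.
have diag := mul_bin_diag (2 * l).+2 l; have down := mul_bin_down (2 * l).+1 l.
rewrite expnS (_ : 2 * l.+1 = (2 * l).+2); last lia.
move: diag down => /=; rewrite (_ : (2 * l).+1 - l = l.+1); last lia.
nia.
Qed.

Lemma central_bin_exp_le_pnw n l q : 3 * l + 2 * l * q <= n ->
  'C(2 * l, l) ^ q <= pnw n.
Proof.
move=> le_n; set k := n - 2 * l * q.
rewrite -size_balanced_words -(size_map (cat (nseq k true))).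
apply: pnw_ge_size => [|w /mapP[v /mem_balanced_words[szv bal] ->]].
  rewrite map_inj_uniq ?balanced_words_uniq // => u v /eqP.
  by rewrite eqseq_cat // eqxx => /eqP.
split; first by rewrite size_cat size_nseq szv /k; lia.
by apply: prefix_normal_nseq_cat bal; rewrite /k; lia.
Qed.

Lemma expn2_le_pnw n l : 0 < l ->
  2 ^ n <= pnw n * (2 * l).+1 ^ (n %/ (2 * l)) * 2 ^ (5 * l).
Proof.
move=> l_gt0.
have [lt_nl | le_ln] := ltnP n (3 * l).
  (* No room for the initial run: the factor [2 ^ (5 * l)] alone exceeds [2 ^ n], and the all-ones
     word makes [pnw n] positive. *)
  have pnw_gt0 : 0 < pnw n.
    by have := @central_bin_exp_le_pnw n 0 0; rewrite bin0 exp1n; apply.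
  rewrite (leq_trans _ (leq_pmull _ _)) ?leq_exp2l //; first lia.
  by rewrite muln_gt0 pnw_gt0 expn_gt0.
set q := (n - 3 * l) %/ (2 * l).
have le_q : 3 * l + 2 * l * q <= n.
  by have := leq_trunc_div (n - 3 * l) (2 * l); rewrite /q; lia.
have lt_q : n - 3 * l < 2 * l * q.+1.
  by rewrite [2 * l * _]mulnC ltn_ceil // muln_gt0.
have le_qn : q <= n %/ (2 * l) by rewrite leq_div2r // leq_subr.
(* The run takes [3 * l] letters and the remainder of the division fewer than [2 * l], hence the
   [5 * l]. *)
apply: (@leq_trans (4 ^ (l * q) * 2 ^ (5 * l))).
  by rewrite (_ : 4 = 2 ^ 2) // -expnM -expnD leq_exp2l //; lia.
rewrite leq_mul2r expn_eq0 /=.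
apply: (@leq_trans ('C(2 * l, l) ^ q * (2 * l).+1 ^ q)).
  have [->|q_gt0] := posnP q; first by rewrite muln0.
  by rewrite expnM -expnMn leq_exp2r ?central_bin_ge.
by rewrite leq_mul ?(central_bin_exp_le_pnw le_q) // leq_pexp2l.
Qed.

Local Open Scope classical_set_scope.
Local Open Scope ring_scope.

Lemma powR2E (R : realType) (x : R) : 2 `^ x = expR (x * ln 2).
Proof. by rewrite /powR gt_eqF. Qed.

Lemma exprn_expR (R : realType) (x : R) n : 0 < x -> x ^+ n = expR (n%:R * ln x).
Proof. by move=> x_gt0; rewrite expRM_natl lnK. Qed.

(** With s = sqrt (n ln n) and s < l <= 2 s, the factor [2 ^ (5 * l)] costs at most 10 s bits and
    the block factors at most s nats, that is s / ln 2 bits; this is the constant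
    [10 + (ln 2)^-1]. *)
Lemma pnw_ge_powR (R : realType) (n : nat) : (4 < n)%N -> expR 1 <= n%:R :> R ->
  2 `^ (n%:R - (10 + (ln 2)^-1) * Num.sqrt (n%:R * ln n%:R)) <= (pnw n)%:R :> R.
Proof.
move=> n_gt4 le_en; set s := Num.sqrt _.
have n_gt0 : 0 < n%:R :> R by rewrite ltr0n (ltn_trans _ n_gt4).
have ln2_gt0 : 0 < ln 2 :> R by rewrite ln_gt0 // ltr1n.
have ln_ge1 : 1 <= ln n%:R :> R by rewrite -[leLHS]expRK ler_ln ?posrE ?expR_gt0.
have n_ge5 : 5 <= n%:R :> R by rewrite ler_nat.
have s2 : s ^+ 2 = n%:R * ln n%:R by rewrite sqr_sqrtr // mulr_ge0 ?ler0n ?(le_trans _ ln_ge1).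
have s_ge0 : 0 <= s by apply: sqrtr_ge0.
have ln_lt : ln n%:R < n%:R :> R by exact: ln_sublinear.
have s_ge1 : 1 <= s by nra.
have s_le : s <= n%:R by nra.
set l := (Num.truncn s).+1.
have l_gt : s < l%:R by exact: truncnS_gt.
have l_le : l%:R <= 2 * s.
  have trunc_le : (Num.truncn s)%:R <= s by rewrite truncn_le.
  by rewrite -[leLHS]natr1; lra.
(* Since 2 l + 1 <= 5 n <= n^2, each of the q <= n / (2 s) factors contributes at most 2 ln n to the
   exponent, for a total of at most n ln n / s = s. *)
have blocks_le : (2 * l).+1%:R ^+ (n %/ (2 * l)) <= expR s.
  rewrite exprn_expR ?ltr0n // ler_expR.
  have lnl : ln (2 * l).+1%:R <= 2 * ln n%:R :> R.
    rewrite mulr_natl -lnXn // ler_ln ?posrE ?ltr0n ?exprn_gt0 //.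
    rewrite -[leLHS]natr1 natrM (@le_trans _ _ (5 * n%:R)) //; first lra.
    by rewrite expr2 ler_wpM2r // ltW.
  have q_le : (n %/ (2 * l))%:R * (2 * l%:R) <= n%:R :> R.
    by rewrite -!natrM ler_nat leq_trunc_div.
  have q_ge0 : 0 <= (n %/ (2 * l))%:R :> R by [].
  move: q_le q_ge0; set q := _%:R => q_le q_ge0.
  have qs_le : q * (2 * s) <= n%:R.
    by apply: le_trans q_le; rewrite ler_wpM2l //; lra.
  apply: (@le_trans _ _ (q * (2 * ln n%:R))); first by rewrite ler_wpM2l.
  have s_gt0 : 0 < s by lra.
  rewrite -(ler_pM2r s_gt0) -expr2 s2.
  rewrite (_ : _ * s = q * (2 * s) * ln n%:R); last ring.
  by rewrite ler_wpM2r //; lra.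
have pow_le : 2 ^+ (5 * l) <= expR (10 * s * ln 2) :> R.
  rewrite exprn_expR // ler_expR (ler_wpM2r (ltW ln2_gt0)) //.
  rewrite natrM (_ : 10 * s = 5 * (2 * s)); last ring.
  by rewrite ler_wpM2l.
rewrite powR2E mulrBl expRB ler_pdivrMr ?expR_gt0 // -exprn_expR //.
have := @expn2_le_pnw n l isT; rewrite -(ler_nat R) !natrM !natrX => /le_trans; apply.
rewrite -mulrA ler_wpM2l //.
rewrite (_ : _ * ln 2 = s + 10 * s * ln 2); last by field; rewrite gt_eqF.
by rewrite expRD ler_pM // exprn_ge0.
Qed.

Lemma sqrt_mul_ln_le (R : realType) (k : R) : 0 < k ->
  \forall n \near \oo, Num.sqrt (n%:R * ln n%:R) <= k * n%:R.
Proof.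
move=> k_gt0; near=> n.
have n_gt0 : 0 < n%:R :> R by near: n; exact: nbhs_infty_gtr.
(* The goal reduces to ln n <= k^2 n. With r = sqrt n, ln n = 2 ln r < 2 r, so r >= 2 / k^2
   suffices. *)
have n_ge : (2 / k ^+ 2) ^+ 2 <= n%:R by near: n; exact: nbhs_infty_ger.
rewrite -[leRHS]ger0_norm ?mulr_ge0 ?(ltW k_gt0) // -sqrtr_sqr.
rewrite ler_wsqrtr // exprMn expr2 [_ * (n%:R * _)]mulrCA ler_wpM2l ?ltW //.
set r := Num.sqrt (n%:R : R).
have r2 : r ^+ 2 = n%:R by rewrite sqr_sqrtr // ltW.
have r_gt0 : 0 < r by rewrite sqrtr_gt0.
have le_r : 2 / k ^+ 2 <= r.
  by rewrite -ler_sqr ?nnegrE ?(ltW r_gt0) ?r2 // divr_ge0 // sqr_ge0.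
rewrite ler_pdivrMr ?exprn_gt0 // in le_r.
rewrite -r2 lnXn // mulr2n.
have := ln_sublinear r_gt0; nra.
Unshelve. all: by end_near. Qed.

Theorem theorem1 (R : realType) :
  (exists2 c : R, 0 < c &
     (fun n : nat => (pnw n)%:R : R) \is
       'Omega_\oo (fun n : nat => 2 `^ (n%:R - c * Num.sqrt (n%:R * ln n%:R)))) /\
  (forall e : R, 0 < e < 2 ->
     (fun n : nat => (pnw n)%:R : R) \is
       'Omega_\oo (fun n : nat => (2 - e) ^+ n)).
Proof.
have ln2_gt0 : 0 < ln 2 :> R by rewrite ln_gt0 // ltr1n.
have c_gt0 : 0 < 10 + (ln 2)^-1 :> R by rewrite addr_gt0 ?invr_gt0.
have pnw_near : \forall n \near \oo,
    2 `^ (n%:R - (10 + (ln 2)^-1) * Num.sqrt (n%:R * ln n%:R)) <= (pnw n)%:R :> R.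
  near=> n; apply: pnw_ge_powR; near: n; first exact: nbhs_infty_gt.
  exact: nbhs_infty_ger.
split=> [|e /andP[e_gt0 e_lt2]].
  exists (10 + (ln 2)^-1) => //; rewrite qualifE; apply/asboolP; exists 1 => //.
  near=> n; rewrite mul1r !ger0_norm ?powR_ge0 //; near: n; exact: pnw_near.
have e2_gt0 : 0 < 2 - e by rewrite subr_gt0.
(* This slope is chosen so that the loss c sqrt (n ln n) ln 2, with c = 10 + 1 / ln 2, is eventually
   at most n (ln 2 - ln (2 - e)). *)
have k_gt0 : 0 < (ln 2 - ln (2 - e)) / ((10 + (ln 2)^-1) * ln 2).
  by rewrite divr_gt0 ?mulr_gt0 // subr_gt0 ltr_ln ?posrE // ltrBlDr ltrDl.
have sqrt_near := sqrt_mul_ln_le k_gt0.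
rewrite qualifE; apply/asboolP; exists 1 => //; near=> n.
rewrite mul1r !ger0_norm ?exprn_ge0 ?(ltW e2_gt0) //.
apply: (@le_trans _ _
    (2 `^ (n%:R - (10 + (ln 2)^-1) * Num.sqrt (n%:R * ln n%:R)))); last by near: n.
rewrite powR2E exprn_expR // ler_expR.
have : Num.sqrt (n%:R * ln n%:R) <=
    (ln 2 - ln (2 - e)) / ((10 + (ln 2)^-1) * ln 2) * n%:R by near: n.
rewrite mulrAC ler_pdivlMr ?mulr_gt0 //; nra.
Unshelve. all: by end_near. Qed.
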